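(* There exists a function $\phi$ of two variables such that for every alphabet size $\sigma$, every integer $k \ge 1$ and every integer $n \ge 2k$, $$\Omega(n,k,\sigma) \le \phi(k,\sigma).$$ (In particular the bound $\phi(k,\sigma)$ does not depend on $n$.)
   Context: An alphabet $\Sigma$ is a finite set of characters, and its size is $\sigma = |\Sigma|$. For a string $S$ of length $n$ over $\Sigma$, $S[i]$ is its $i$th character and $S[i,j]$ is the substring from $S[i]$ to $S[j]$ if $j \ge i$, and the empty string otherwise. Let $\$$ be a symbol not in $\Sigma$. The (non-compact, or simple) suffix tree of $S$ is the rooted tree, with edges directed away from the root, with exactly $n$ leaves numbered $1,\dots,n$, in which each edge is labelled by a single character of $\Sigma \cup \{\$\}$, distinct edges leaving the same node have distinct labels, and for each $j$ the concatenation of the edge labels along the path from the root to leaf $j$ is $S[j,n]$ followed by $\$$. For a string $S$ of length $n \ge 2$, the growth $\gamma(S)$ is defined as follows: among the internal nodes on the path from the root to leaf $1$ in the suffix tree of $S$ that have at least two children, let $v$ be the one closest to leaf $1$; then $\gamma(S)$ is one less than the number of edges on the path from $v$ to leaf $1$. (For example, $\gamma(aabccb)=5$.) $\Omega(n,k,\sigma)$ denotes the number of strings of length $n$ with growth $k$ over an alphabet of size $\sigma$. *)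

(* Defs.v *)
From Stdlib Require Import List.
From mathcomp Require Import all_boot.
From mathcomp Require Import boolp.
Set Implicit Arguments.
Unset Strict Implicit.
Unset Printing Implicit Defensive.

(* Edge labels live in [option A]: [Some a] is the character [a] and [None] is
   the end marker $.  Leaves carry their number; an internal node is the list
   of its outgoing edges (label, subtree). *)
Inductive tree (A : Type) : Type :=
| Leaf of nat
| Node of seq (option A * tree A).
Arguments Leaf {A} _.
Arguments Node {A} _.

Fixpoint leaves (A : Type) (t : tree A) : seq nat :=
  match t with
  | Leaf j => [:: j]
  | Node es => flatten [seq leaves e.2 | e <- es]
  end.

(* [down t w u]: a path leads downwards from the root of [t] to an occurrence
   of [u] in [t], and the labels along it spell [w]. *)
Inductive down (A : Type) : tree A -> seq (option A) -> tree A -> Prop :=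
| down_nil t : down t [::] t
| down_cons es c u w v : In (c, u) es -> down u w v -> down (Node es) (c :: w) v.

(* S[j,n]$, with positions counted from 1. *)
Definition suffix_end (A : Type) (S : seq A) (j : nat) : seq (option A) :=
  rcons (map Some (drop j.-1 S)) None.

(* Requiring [es <> [::]] at every node makes the [Leaf]s the only leaves. *)
Definition is_suffix_tree (A : eqType) (S : seq A) (t : tree A) : Prop :=
  [/\ perm_eq (leaves t) (iota 1 (size S)),
      forall w es, down t w (Node es) -> es <> [::] /\ uniq (map fst es)
    & forall j, 1 <= j <= size S -> down t (suffix_end S j) (Leaf j)].

(* [v] is a node with at least two children on the path from the root of [t]
   to leaf 1, and [w] spells the part of that path from [v] to leaf 1. *)
Definition branching_above_leaf1 (A : Type) (t v : tree A)
    (w : seq (option A)) : Prop :=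
  exists es w0,
    [/\ v = Node es, 1 < size es, down t w0 v & down v w (Leaf 1)].

(* gamma(S) = k; [growth_exists] and [growth_unique] below show that this
   defines a function of S as soon as S has length at least 2. *)
Definition has_growth (A : eqType) (S : seq A) (k : nat) : Prop :=
  exists t v w,
    [/\ is_suffix_tree S t, branching_above_leaf1 t v w,
        forall v' w', branching_above_leaf1 t v' w' -> size w <= size w'
      & size w = k.+1].

Definition Omega (A : finType) (n k : nat) : nat :=
  #|[set S : n.-tuple A | `[< has_growth S k >]]|.

Section WellDefined.
Variable A : eqType.
Implicit Types (t u v : tree A) (S : seq A) (w x y : seq (option A)).
Implicit Types (es : seq (option A * tree A)).

Lemma down_nilE t v : down t [::] v -> v = t.
Proof. by move=> d; inversion d. Qed.

Lemma down_consE t c w v : down t (c :: w) v ->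
  exists es u, [/\ t = Node es, In (c, u) es & down u w v].
Proof. by move=> d; inversion d; subst; exists es, u. Qed.

Lemma down_cat t x u y v : down t x u -> down u y v -> down t (x ++ y) v.
Proof.
elim=> [//|es c u' w v' h _ IH] d /=; exact: down_cons h (IH d).
Qed.

Lemma down_split t x y v :
  down t (x ++ y) v -> exists u, down t x u /\ down u y v.
Proof.
elim: x t => [|c x IH] t /= d; first by exists t; split=> //; constructor.
have [es [u [-> h /IH[u' [d1 d2]]]]] := down_consE d.
by exists u'; split=> //; apply: down_cons d1.
Qed.

Lemma mem_flatten_In (f : option A * tree A -> seq nat) es e j :
  In e es -> j \in f e -> j \in flatten (map f es).
Proof.
elim: es => [//|a es IH] /= [->|h] je; rewrite mem_cat ?je //.
by rewrite IH ?orbT.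
Qed.

Lemma flatten_mem_In (f : option A * tree A -> seq nat) es j :
  j \in flatten (map f es) -> exists2 e, In e es & j \in f e.
Proof.
elim: es => [//|a es IH] /=; rewrite mem_cat => /orP[h|/IH[e h1 h2]].
  by exists a => //; left.
by exists e => //; right.
Qed.

Lemma uniq_flatten_In (f : option A * tree A -> seq nat) es e e' j :
  uniq (flatten (map f es)) -> In e es -> In e' es ->
  j \in f e -> j \in f e' -> e = e'.
Proof.
elim: es => [//|a es IH] /=; rewrite cat_uniq => /and3P[_ /hasPn nh u].
case=> [?|h] [?|h'] je je'; subst=> //.
- by move/negP: (nh _ (mem_flatten_In h' je'))=> [].
- by move/negP: (nh _ (mem_flatten_In h je))=> [].
- exact: IH.
Qed.

Lemma uniq_flatten_sub (f : option A * tree A -> seq nat) es e :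
  uniq (flatten (map f es)) -> In e es -> uniq (f e).
Proof.
by elim: es => [//|a es IH] /=; rewrite cat_uniq => /and3P[ua _ u] [<-|/IH->].
Qed.

Lemma down_leaves t w v j : down t w v -> j \in leaves v -> j \in leaves t.
Proof.
elim=> [//|es c u w' v' h _ IH] /IH.
exact: (@mem_flatten_In (fun e => leaves e.2) es (c, u)).
Qed.

Lemma down_leaf_inj t x y j : uniq (leaves t) ->
  down t x (Leaf j) -> down t y (Leaf j) -> x = y.
Proof.
move=> ut d; move: d ut y; move El: (Leaf j) => l d.
elim: d El => [t'|es c u w v h d IH] El ut [|c0 y]; subst=> //.
- by move=> /down_consE[? [? []]].
- by move=> /down_nilE.
case/down_consE=> es0 [u0 [[?] h0 d0]]; subst es0.
have ju : j \in leaves u by apply: (down_leaves d); rewrite inE.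
have ju0 : j \in leaves u0 by apply: (down_leaves d0); rewrite inE.
have [? ?] : (c, u) = (c0, u0).
  exact: (@uniq_flatten_In (fun e => leaves e.2) es _ _ j).
subst c0 u0; congr cons; apply: IH => //.
exact: (@uniq_flatten_sub (fun e => leaves e.2) es (c, u)).
Qed.

Lemma uniq_label_In es c u u' :
  uniq (map fst es) -> In (c, u) es -> In (c, u') es -> u = u'.
Proof.
have lab e es' : In e es' -> e.1 \in [seq p.1 | p : option A * tree A <- es'].
  elim: es' => [//|a es' IH] /= [->|/IH h]; rewrite inE ?eqxx //.
  by rewrite h orbT.
elim: es => [//|a es IH] /= /andP[na ue] [E|h] [E'|h']; try subst a.
- by case: E'.
- by rewrite (lab _ _ h') in na.
- by rewrite (lab _ _ h) in na.
- exact: IH.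
Qed.

Lemma down_det t x u v :
  (forall w es, down t w (Node es) -> uniq (map fst es)) ->
  down t x u -> down t x v -> u = v.
Proof.
move=> ul d; elim: d ul v => [t'|es c u' w v' h d IH] ul v; first by move/down_nilE.
case/down_consE=> es0 [u0 [[?] h0 d0]]; subst es0.
have E : u' = u0 by apply: (uniq_label_In (ul _ _ (down_nil _)) h).
subst u0; apply: IH => // w0 es0 d1; apply: (ul (c :: w0)); exact: down_cons d1.
Qed.

Lemma down_to_leaf t : (forall w es, down t w (Node es) -> es <> [::]) ->
  exists w j, down t w (Leaf j).
Proof.
move: t; fix IH 1 => -[j|[|[c u] es]] ne.
- by exists [::], j; constructor.
- by have := ne _ _ (down_nil _).
have [|w [j d]] := IH u.
  by move=> w es' d; apply: (ne (c :: w)); apply: down_cons d; left.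
by exists (c :: w), j; apply: down_cons d; left.
Qed.

Definition branching_word S w : Prop :=
  exists i j c c' x x',
    [/\ 1 <= i <= size S, 1 <= j <= size S, c <> c',
        suffix_end S i = w ++ c :: x & suffix_end S j = w ++ c' :: x'].

Lemma branching_wordP S t w : is_suffix_tree S t ->
  branching_word S w <->
  exists es, 1 < size es /\ down t w (Node es).
Proof.
case=> pl wf sf; have ul : uniq (leaves t) by rewrite (perm_uniq pl) iota_uniq.
split=> [[i [j [c [c' [x [x' [hi hj cc si sj]]]]]]]|].
  have := sf _ hi; rewrite si => /down_split[v [dv dx]].
  have := sf _ hj; rewrite sj => /down_split[v' [dv' dx']].
  have ? : v' = v by apply: down_det dv' dv => y es /wf[].
  subst v'; have [es [u [? h _]]] := down_consE dx; subst v.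
  have [es' [u' [[?] h' _]]] := down_consE dx'; subst es'.
  exists es; split=> //.
  case: es h h' {dx dx' dv dv'} => [|[d p] [|? ?]] //= [[? _]|//] [[? _]|//].
  by subst.
case=> -[|[c u] [|[c' u'] es]] [] // _ d.
have [_ /andP[cc _]] := wf _ _ d.
have leafat b r : In (b, r) [:: (c, u), (c', u') & es] ->
    exists i x, 1 <= i <= size S /\ suffix_end S i = w ++ b :: x.
  move=> h; have dr x v : down r x v -> down t (w ++ b :: x) v.
    by move=> dx; apply: (down_cat d); apply: down_cons dx.
  have [|x [i di]] := @down_to_leaf r.
    by move=> y es' dy; have [] := wf _ _ (dr _ _ dy).
  have hi : 1 <= i <= size S.
    have : i \in leaves t by apply: (down_leaves (dr _ _ di)); rewrite inE.
    by rewrite (perm_mem pl) mem_iota add1n ltnS.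
  by exists i, x; split=> //; apply: down_leaf_inj ul (sf _ hi) (dr _ _ di).
have [|i [x [hi si]]] := leafat c u; first by left.
have [|j [x' [hj sj]]] := leafat c' u'; first by right; left.
exists i, j, c, c', x, x'; split=> //.
by move=> E; move: cc; rewrite E inE eqxx.
Qed.

Lemma branching_above_leaf1P S t w : is_suffix_tree S t -> 0 < size S ->
  (exists v, branching_above_leaf1 t v w) <->
  exists w0, w0 ++ w = suffix_end S 1 /\ branching_word S w0.
Proof.
move=> st S0; have [pl wf sf] := st.
have ul : uniq (leaves t) by rewrite (perm_uniq pl) iota_uniq.
have d1 := sf 1 S0; split.
  case=> v [es [w0 [-> ses dv dl]]]; exists w0; split.
    exact: down_leaf_inj ul (down_cat dv dl) d1.
  by apply/(branching_wordP _ st); exists es.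
case=> w0 [E /(branching_wordP _ st)[es [ses dv]]].
move: d1; rewrite -E => /down_split[v [dv' dl]].
have ? : v = Node es by apply: down_det dv' dv => y es' /wf[].
by subst; exists (Node es), es, w0.
Qed.

Lemma growth_unique S k k' :
  0 < size S -> has_growth S k -> has_growth S k' -> k = k'.
Proof.
move=> S0 [t [v [w [st b m sw]]]] [t' [v' [w' [st' b' m' sw']]]].
apply/eqP; rewrite -eqSS -sw -sw' eqn_leq; apply/andP; split.
  have /(branching_above_leaf1P _ st' S0)
    /(branching_above_leaf1P _ st S0)[u bu] : exists v', branching_above_leaf1 t' v' w' by exists v'.
  exact: m bu.
have /(branching_above_leaf1P _ st S0)
  /(branching_above_leaf1P _ st' S0)[u bu] : exists v, branching_above_leaf1 t v w by exists v.
exact: m' bu.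
Qed.

(* A suffix tree is built as the trie of a prefix-free list of numbered words. *)
Notation items := (seq (seq (option A) * nat)).

Definition tails (c : option A) (s : items) : items :=
  pmap (fun p => if p.1 is d :: w then
                   if d == c then Some (w, p.2) else None else None) s.

Definition heads (s : items) : seq (option A) :=
  undup (pmap (fun p => ohead p.1) s).

Fixpoint trie (m : nat) (s : items) : tree A :=
  if m is m'.+1 then
    if s is [:: ([::], j)] then Leaf j
    else Node [seq (c, trie m' (tails c s)) | c <- heads s]
  else Node [::].

Lemma mem_tails c s w j : ((w, j) \in tails c s) = ((c :: w, j) \in s).
Proof.
elim: s => [//|[[|d x] i] s IH]; rewrite [RHS]in_cons /tails /= -/(tails c s).
  exact: IH.
case: eqP => [->|dc]; first by rewrite in_cons IH -!pair_eqE /= eqseq_cons eqxx.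
by rewrite IH -pair_eqE /= eqseq_cons eq_sym; case: eqP dc.
Qed.

Lemma mem_heads s c : (c \in heads s) = has (fun p => ohead p.1 == Some c) s.
Proof.
rewrite mem_undup; elim: s => [//|[[|d x] i] s IH] //=.
by rewrite inE IH eq_sym.
Qed.

Definition good (m : nat) (s : items) : Prop :=
  [/\ s <> [::], uniq s, forall w j, (w, j) \in s -> size w < m
    & forall x y i j, (x, i) \in s -> (x ++ y, j) \in s -> (x, i) = (x ++ y, j)].

Lemma good_tails m s c : good m.+1 s -> c \in heads s -> good m (tails c s).
Proof.
case=> ns us ms pf; rewrite mem_heads => /hasP[[[|d x] i] h //= /eqP[dc]].
subst d; split.
- by have := mem_tails c s x i; rewrite h => /esym; case: (tails c s).
- rewrite /tails; elim: s us {ns ms pf h} => [//|[[|d y] j] s IH] /= /andP[na us].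
    exact: IH.
  case: eqP => [E|_] /=; last exact: IH.
  subst d.
  rewrite IH // andbT -/(tails c s) mem_tails.
  by apply/negP => h; move: na; rewrite h.
- by move=> w j; rewrite mem_tails => /ms.
- move=> y z k j; rewrite !mem_tails => h1 h2.
  by have [<- ->] := pf (c :: y) z k j h1 h2.
Qed.

Lemma good_nil m s j : good m s -> ([::], j) \in s -> s = [:: ([::], j)].
Proof.
case=> ns us _ pf h.
have e p : p \in s -> p = ([::], j).
  by case: p => w i hw; rewrite -(pf [::] w j i h hw).
case: s {ns pf} us h e => [//|p [|q s]] us h e; first by rewrite (e p) ?mem_head.
move: us; rewrite (e p) ?mem_head // (e q) /= ?inE ?eqxx ?orbT //.
Qed.

Lemma good_cons m s :
  good m s -> (forall j, s <> [:: ([::], j)]) ->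
  all (fun p => p.1 != [::]) s.
Proof.
move=> g ns; apply/allP=> -[[|c w] j] // h.
by case: (ns j); apply: good_nil g h.
Qed.

Lemma trieP m s : good m.+1 s ->
  (exists j, s = [:: ([::], j)]) \/
  (all (fun p => p.1 != [::]) s /\
   trie m.+1 s = Node [seq (c, trie m (tails c s)) | c <- heads s]).
Proof.
move=> g.
have [[j ->]|n] := pselect (exists j, s = [:: ([::], j)]); first by left; exists j.
right; split; first by apply: good_cons g _ => j E; apply: n; exists j.
by case: s g n => [|[[|c w] j] [|p s]] //= _ n; case: n; exists j.
Qed.

Lemma In_map_mem (f : option A -> tree A) cs c u :
  In (c, u) [seq (c, f c) | c <- cs] <-> c \in cs /\ u = f c.
Proof.
elim: cs => [|d cs IH] /=; first by split=> // -[].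
rewrite inE; split.
  case=> [[-> ->]|/IH[-> ->]]; by rewrite ?eqxx ?orbT.
case=> /orP[/eqP->|h] E; first by left; rewrite E.
by right; apply/IH.
Qed.

Lemma tails_perm s cs : uniq cs -> all (fun p => p.1 != [::]) s ->
  {subset heads s <= cs} ->
  perm_eq (flatten [seq map snd (tails c s) | c <- cs]) (map snd s).
Proof.
move=> ucs; elim: s => [_ _|[[|d x] i] s IH] //=.
  by elim: cs {ucs} => //= c cs ->.
move=> ne sub; have dcs : d \in cs by apply: sub; rewrite mem_heads /= eqxx.
have {}IH : perm_eq (flatten [seq map snd (tails c s) | c <- cs]) (map snd s).
  by apply: IH => // c; rewrite mem_heads => h; apply: sub; rewrite mem_heads /= h orbT.
apply/permP => p; rewrite -(perm_cons i) in IH; rewrite -(permP IH) /=.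
rewrite !count_flatten !sumnE !big_map (bigD1_seq d) //= [in RHS](bigD1_seq d) //=.
rewrite /tails /= eqxx /= addnA; congr (_ + _).
by apply: eq_bigr => c; rewrite eq_sym => /negPf->.
Qed.

Lemma trie_leaves m s : good m s -> perm_eq (leaves (trie m s)) (map snd s).
Proof.
elim: m s => [s [ns _ h _]|m IH s g].
  by case: s ns h => [//|[w j] s] _ /(_ w j); rewrite mem_head => /(_ isT).
have [[j ->] //|[ne ->]] := trieP g.
rewrite /= -map_comp /=.
apply: (perm_trans _ (@tails_perm s (heads s) (undup_uniq _) ne _)) => //.
have : all (mem (heads s)) (heads s) by apply/allP.
elim: {2 3 4}(heads s) => [//|c cs IHc] /= /andP[hc /IHc hcs].
by apply: perm_cat hcs; apply: IH; apply: good_tails g hc.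
Qed.

Lemma trie_down m s w j :
  good m s -> (w, j) \in s -> down (trie m s) w (Leaf j).
Proof.
elim: m s w => [s w [_ _ h _] /h //|m IH s w g h].
have [[i E]|[ne ->]] := trieP g.
  by move: h; rewrite E inE => /eqP[-> ->]; constructor.
case: w h => [h|c w h]; first by have /= := allP ne _ h.
have hc : c \in heads s by rewrite mem_heads; apply/hasP; exists (c :: w, j).
apply: (@down_cons _ _ c (trie m (tails c s))); first exact/In_map_mem.
by apply: IH; [apply: good_tails g hc|rewrite mem_tails].
Qed.

Lemma trie_wf m s w es :
  good m s -> down (trie m s) w (Node es) -> es <> [::] /\ uniq (map fst es).
Proof.
elim: m s w => [s w [ns _ h _]|m IH s w g].
  by case: s ns h => [//|[x j] s] _ /(_ x j); rewrite mem_head => /(_ isT).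
have [[i ->]|[ne ->]] := trieP g; first by move=> d; inversion d.
case: w => [/down_nilE[->]|c w].
  split; last by rewrite -map_comp map_id undup_uniq.
  case: s g ne => [[] //|[[|c w] j] s] // _ _.
  have : c \in heads ((c :: w, j) :: s) by rewrite mem_heads /= eqxx.
  by case: (heads _).
case/down_consE=> es' [u [[<-] /In_map_mem[hc ->] d]].
by apply: IH d; apply: good_tails g hc.
Qed.

Lemma suffix_end_prefix S i j y : 1 <= i <= size S -> 1 <= j <= size S ->
  suffix_end S i ++ y = suffix_end S j -> i = j /\ y = [::].
Proof.
move=> /andP[i0 iS] /andP[j0 jS]; rewrite /suffix_end => E.
have nN T : None \notin map (@Some A) T by elim: T.
have y0 : y = [::].
  case/lastP: y E => [//|y c]; rewrite -rcons_cat => /rcons_inj[E _].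
  by move: (nN (drop j.-1 S)); rewrite -E mem_cat mem_rcons inE eqxx.
move: E; rewrite y0 cats0 => /(congr1 size).
rewrite !size_rcons !size_map !size_drop => -[E]; split=> //.
case: i j i0 iS j0 jS E => [//|i] [//|j] _ iS _ jS /= E; congr _.+1.
by rewrite -(subKn (ltnW iS)) E subKn // ltnW.
Qed.

Lemma suffix_tree_exists S : 0 < size S -> exists t, is_suffix_tree S t.
Proof.
move=> S0; pose s := [seq (suffix_end S j, j) | j <- iota 1 (size S)].
have ms w j : ((w, j) \in s) -> w = suffix_end S j /\ 1 <= j <= size S.
  case/mapP=> i; rewrite mem_iota add1n ltnS => h [-> ->]; by split.
have g : good (size S).+2 s.
  split.
  - by rewrite /s; case: (size S) S0.
  - by rewrite map_inj_uniq ?iota_uniq // => i j [].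
  - move=> w j /ms[-> _]; rewrite size_rcons size_map size_drop !ltnS.
    exact: leq_subr.
  - move=> x y i j /ms[-> hi] /ms[E hj].
    by have [-> ->] := suffix_end_prefix hi hj E; rewrite cats0.
exists (trie (size S).+2 s); split.
- by apply: (perm_trans (trie_leaves g)); rewrite -map_comp map_id.
- by move=> w es; apply: trie_wf.
- move=> j hj; apply: trie_down => //; apply: map_f.
  by rewrite mem_iota add1n ltnS.
Qed.

Lemma diverge x y : (forall z, x ++ z <> y) -> (forall z, y ++ z <> x) ->
  exists w c c' x' y', [/\ c <> c', x = w ++ c :: x' & y = w ++ c' :: y'].
Proof.
elim: x y => [y /(_ y) //|a x IH [_ /(_ (a :: x)) //|b y]] h1 h2.
have [E|n] := pselect (a = b); last by exists [::], a, b, x, y.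
subst b; have [||w [c [c' [x' [y' [n -> ->]]]]]] := IH y.
- by move=> z E; apply: (h1 z); rewrite /= E.
- by move=> z E; apply: (h2 z); rewrite /= E.
by exists (a :: w), c, c', x', y'.
Qed.

Lemma growth_exists S : 1 < size S -> exists k, has_growth S k.
Proof.
move=> S1; have S0 := ltnW S1; have [t st] := suffix_tree_exists S0.
have h1 : 1 <= 1 <= size S by rewrite S0.
have h2 : 1 <= 2 <= size S by rewrite S1.
have [||w0 [c [c' [x [y [n E1 E2]]]]]] := @diverge (suffix_end S 1) (suffix_end S 2).
- by move=> z /(suffix_end_prefix h1 h2)[].
- by move=> z /(suffix_end_prefix h2 h1)[].
have ex : exists k, `[< exists v w, branching_above_leaf1 t v w /\ size w = k >].
  have [v bv] : exists v, branching_above_leaf1 t v (c :: x).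
    apply/(branching_above_leaf1P _ st S0); exists w0; split=> //.
    by exists 1, 2, c, c', x, y.
  by exists (size (c :: x)); apply/asboolP; exists v, (c :: x).
case: (ex_minnP ex) => k /asboolP[v [w [bv sw]]] mk.
have [es [w1 [Ev _ _ dl]]] := bv.
have [k0|k0] := posnP k.
  by move: sw dl; rewrite k0 Ev => /size0nil -> /down_nilE.
exists k.-1, t, v, w; split=> //; last by rewrite prednK.
move=> v' w' b'; rewrite sw; apply: mk; apply/asboolP; by exists v', w'.
Qed.

End WellDefined.

(* Main.v *)
Require Import Defs.
From mathcomp Require Import all_boot.
From mathcomp Require Import boolp zify.

(** Let [S] have length [n] and growth [k], and let [v] be the branching node
    that realises the growth.  The path from [v] to leaf 1 spells [k.+1]
    letters, so the string of [v] is the prefix of [S] of length [n - k], and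
    branching at [v] means that this prefix occurs in [S] a second time, at
    some offset [p] with [1 <= p <= k] ([growth_repeats_prefix]).  Hence
    [S[i] = S[p + i]] for all positions [i < n - k], counted from 0, and once
    [p] is known, the last [k] characters determine the others from right to left
    ([repeated_prefix_inj]).  With [k] choices for [p] and [#|A| ^ k] choices
    for the last [k] characters, at most [k * #|A| ^ k] strings of length [n]
    have growth [k]. *)

(** The offset is at most [k] because a word of length [size S - k] has to fit
    into the part of [S] that remains after it. *)
Lemma growth_repeats_prefix (A : eqType) (S : seq A) (k : nat) :
  0 < size S -> has_growth S k ->
  exists2 p, 0 < p <= k &
    take (size S - k) (drop p S) = take (size S - k) S.
Proof.
move=> S0 [t [v [w [st b _ sw]]]].
have /(branching_above_leaf1P _ st S0) [w0 [E1 bw]] :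
  exists v, branching_above_leaf1 t v w by exists v.
have sw0 : size w0 = size S - k.
  move/(congr1 size): E1.
  by rewrite size_cat sw size_rcons size_map size_drop /=; lia.
(* Of the two suffixes that diverge after [w0], only one can start at 1. *)
have [j [c [x [hj j1 Ej]]]] : exists j c x,
    [/\ 1 <= j <= size S, j != 1 & suffix_end S j = w0 ++ c :: x].
  case: bw => i [j [c [c' [x [x' [hi hj cc Ei Ej]]]]]].
  have [i1|i1] := eqVneq i 1; last by exists i, c, x.
  have [j1|j1] := eqVneq j 1; last by exists j, c', x'.
  have : w0 ++ c :: x = w0 ++ c' :: x' by rewrite -Ei -Ej i1 j1.
  by move/eqP; rewrite eqseq_cat // eqxx => /eqP[].
have szE := congr1 size Ej.
rewrite size_cat /= sw0 size_rcons size_map size_drop in szE.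
have take_suffix i : size S - k <= size (drop i.-1 S) ->
    take (size S - k) (suffix_end S i) =
    map Some (take (size S - k) (drop i.-1 S)).
  by move=> h; rewrite /suffix_end -cats1 takel_cat ?size_map // map_take.
have some_inj : injective (map (@Some A)) by apply: inj_map => ? ? [].
have tw0 y : take (size S - k) (w0 ++ y) = w0 by rewrite -sw0 take_size_cat.
exists j.-1; first by lia.
apply: some_inj; rewrite -take_suffix; last by rewrite size_drop; lia.
have := take_suffix 1; rewrite /= drop0 => <-; last by lia.
by rewrite Ej -E1 !tw0.
Qed.

(** The repetition expresses each of the first [m] characters by one that
    stands [p] places to its right, so the common part [drop m s] of the two
    words propagates to the left. *)
Lemma repeated_prefix_inj (A : Type) (s s' : seq A) (m p : nat) :
  size s = size s' -> 0 < p ->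
  take m (drop p s) = take m s -> take m (drop p s') = take m s' ->
  drop m s = drop m s' -> s = s'.
Proof.
move=> sz p0 Es Es' Ed.
case: s sz Es Ed => [/esym/size0nil-> //|x0 s0].
set s := x0 :: s0 => sz Es Ed.
have shift r i : take m (drop p r) = take m r -> i < m ->
    nth x0 r i = nth x0 r (p + i).
  by move=> Er im; rewrite -(nth_take _ im) -Er nth_take // nth_drop.
apply: (@eq_from_nth _ x0) => // i _.
(* Induction on the distance from [i] to the common part. *)
move: {-1}(m - i) (leqnn (m - i)) => d.
elim: d i => [|d IH] i id; have [mi|im] := leqP m i.
- by rewrite -(subnKC mi) -!nth_drop Ed.
- by lia.
- by rewrite -(subnKC mi) -!nth_drop Ed.
- by rewrite (shift s) // (shift s') //; apply: IH; lia.
Qed.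

Lemma card_repeated_prefix (A : finType) (n k p : nat) : k <= n -> 0 < p ->
  #|[set S : n.-tuple A | take (n - k) (drop p S) == take (n - k) S]|
    <= #|A| ^ k.
Proof.
move=> kn p0; set R := [set S : n.-tuple A | _].
have sz (S : n.-tuple A) : size (drop (n - k) S) == k.
  by rewrite size_drop size_tuple subKn.
pose last_chars S : k.-tuple A := Tuple (sz S).
have inj : {in R &, injective last_chars}.
  move=> S S'; rewrite !inE => /eqP ES /eqP ES' /(congr1 val) /= E.
  by apply/val_inj/(repeated_prefix_inj _ _ _ _ _ _ p0 ES ES' E); rewrite !size_tuple.
by rewrite -card_tuple -(card_in_imset inj) max_card.
Qed.

Theorem theorem11 :
  exists phi : nat -> nat -> nat,
    forall (A : finType) (k n : nat),
      1 <= k -> 2 * k <= n -> Omega A n k <= phi k #|A|.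
Proof.
exists (fun k sigma => k * sigma ^ k) => A k n k0 kn.
pose R (p : 'I_k) :=
  [set S : n.-tuple A | take (n - k) (drop p.+1 S) == take (n - k) S].
have sub : [set S : n.-tuple A | `[< has_growth S k >]] \subset \bigcup_p R p.
  apply/subsetP => S; rewrite inE => /asboolP /growth_repeats_prefix.
  rewrite size_tuple => -[|[//|p] /= pk E]; first by lia.
  by apply/bigcupP; exists (Ordinal pk); rewrite // inE /= E.
apply: leq_trans (subset_leq_card sub) _.
have -> : k * #|A| ^ k = \sum_(p < k) #|A| ^ k.
  by rewrite sum_nat_const card_ord.
apply: (big_ind2 (fun (T : {set n.-tuple A}) m => #|T| <= m)) => [|T a U b Ta Ub|p _].
- by rewrite cards0.
- by apply: leq_trans (leq_card_setU T U) (leq_add Ta Ub).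
- by apply: card_repeated_prefix => //; lia.
Qed.
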